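(* Let $m\ge 2$, $n\ge 1$ and let $\mathcal{A}=(a_{i_1\cdots i_m})$ be a real $m$-order $n$-dimensional tensor (not necessarily symmetric). A real number $\lambda$ is a Pareto $H$-eigenvalue of $\mathcal{A}$ if and only if there exist a nonempty subset $N\subseteq\{1,2,\ldots,n\}$ and a vector $w=(w_i)_{i\in N}\in\mathbb{R}^{|N|}$ such that $$\mathcal{A}^{N}w^{m-1}=\lambda w^{[m-1]},\qquad w\in\mathbb{R}^{|N|}_{++},$$ $$\sum_{i_2,\ldots,i_m\in N}a_{ii_2\cdots i_m}w_{i_2}w_{i_3}\cdots w_{i_m}\ge 0\quad\text{for all } i\in\{1,2,\ldots,n\}\setminus N.$$ In such a case, the vector $y\in\mathbb{R}^{n}_+$ defined by $y_i=w_i$ for $i\in N$ and $y_i=0$ for $i\in\{1,2,\ldots,n\}\setminus N$ is a Pareto $H$-eigenvector of $\mathcal{A}$ associated to $\lambda$.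
   Context: An $m$-order $n$-dimensional real tensor is an array $\mathcal{A}=(a_{i_1\cdots i_m})$ of real numbers, $i_1,\ldots,i_m\in\{1,\ldots,n\}$. For $x\in\mathbb{R}^n$, $\mathcal{A}x^m=\sum_{i_1,\ldots,i_m=1}^n a_{i_1\cdots i_m}x_{i_1}\cdots x_{i_m}$, and $\mathcal{A}x^{m-1}\in\mathbb{R}^n$ is the vector with components $(\mathcal{A}x^{m-1})_i=\sum_{i_2,\ldots,i_m=1}^n a_{ii_2\cdots i_m}x_{i_2}\cdots x_{i_m}$. Write $x^{[m-1]}=(x_1^{m-1},\ldots,x_n^{m-1})^T$. Vector inequalities are componentwise; $\mathbb{R}^k_+=\{x\in\mathbb{R}^k: x\ge 0\}$ and $\mathbb{R}^k_{++}=\{x\in\mathbb{R}^k: x>0\}$ (all components positive). A real number $\lambda$ is a Pareto $H$-eigenvalue of $\mathcal{A}$ if there is a non-zero $x\in\mathbb{R}^n$ with $\mathcal{A}x^m=\lambda x^Tx^{[m-1]}$, $\mathcal{A}x^{m-1}-\lambda x^{[m-1]}\ge 0$ and $x\ge 0$; such an $x$ is a Pareto $H$-eigenvector associated to $\lambda$. For nonempty $N\subseteq\{1,\ldots,n\}$, the principal sub-tensor $\mathcal{A}^N$ is the $m$-order $|N|$-dimensional tensor obtained by setting $x_i=0$ for $i\notin N$, i.e. $\mathcal{A}^N=(a_{i_1\cdots i_m})_{i_1,\ldots,i_m\in N}$; vectors in $\mathbb{R}^{|N|}$ are indexed by the elements of $N$. *)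

(* Defs.v *)
From mathcomp Require Import all_boot all_order all_algebra.
From mathcomp Require Import reals.

Set Implicit Arguments.
Unset Strict Implicit.
Unset Printing Implicit Defensive.

Import Order.TTheory GRing.Theory Num.Theory.
Local Open Scope ring_scope.

(* Indices range over an arbitrary finite type I, so that the same definitions
   serve tensors of dimension n (I := 'I_n) and their principal sub-tensors,
   whose indices are the elements of N (I := {i : 'I_n | i \in N}). *)
Definition tensor (R : realType) (m : nat) (I : finType) : Type :=
  {ffun m.-tuple I -> R}.

Section Tensors.
Context {R : realType} {I : finType}.
Implicit Types (x : {ffun I -> R}) (lambda : R).

(* A x^m *)
Definition tensor_form {m : nat} (A : tensor R m I) x : R :=
  \sum_(t : m.-tuple I) A t * \prod_(j <- t) x j.

(* A x^(m-1); the order is written m.+1 so that the m summation indices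
   i_2, ..., i_(m+1) form an m-tuple. *)
Definition tensor_map {m : nat} (A : tensor R m.+1 I) x : {ffun I -> R} :=
  [ffun i => \sum_(t : m.-tuple I) A [tuple of i :: t] * \prod_(j <- t) x j].

(* x^[k] *)
Definition vec_pow (k : nat) x : {ffun I -> R} := [ffun i => x i ^+ k].

Definition Pareto_H_eigenvector {m : nat} (A : tensor R m.+1 I) lambda x
    : Prop :=
  [/\ x != 0,
      tensor_form A x = lambda * \sum_i x i * vec_pow m x i,
      forall i, 0 <= tensor_map A x i - lambda * vec_pow m x i &
      forall i, 0 <= x i].

Definition Pareto_H_eigenvalue {m : nat} (A : tensor R m.+1 I) lambda : Prop :=
  exists x, Pareto_H_eigenvector A lambda x.

Definition principal_subtensor {m : nat} (A : tensor R m I) (N : {set I})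
    : tensor R m {i : I | i \in N} :=
  [ffun t : m.-tuple {i : I | i \in N} => A [tuple of map val t]].

Definition zero_ext (N : {set I}) (w : {ffun {i : I | i \in N} -> R})
    : {ffun I -> R} :=
  [ffun i => if insub i is Some j then w j else 0].

End Tensors.

(* The last condition is about rows i outside N, hence is not expressible
   through principal_subtensor A N. *)
Definition Pareto_H_support {R : realType} {I : finType} {m : nat}
    (A : tensor R m.+1 I) (lambda : R) (N : {set I})
    (w : {ffun {i : I | i \in N} -> R}) : Prop :=
  [/\ forall i : {i : I | i \in N},
        tensor_map (principal_subtensor A N) w i = lambda * vec_pow m w i,
      forall i : {i : I | i \in N}, 0 < w i &
      forall i : I, i \notin N ->
        0 <= \sum_(t : m.-tuple {i : I | i \in N})
               A [tuple of i :: map val t] * \prod_(j <- t) w j].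

(* Main.v *)
(* A Pareto H-eigenvector x satisfies the complementarity condition
   x_i ((A x^(m-1))_i - lambda x_i^(m-1)) = 0 for every i, because these terms
   are nonnegative and sum to A x^m - lambda x^T x^[m-1] = 0. Taking for N the
   support of x, complementarity is the eigenvalue equation on N, while off N
   the inequality loses its lambda-term since x_i = 0. *)

Require Import Defs.
From mathcomp Require Import all_boot all_order all_algebra.
From mathcomp Require Import reals.

Set Implicit Arguments.
Unset Strict Implicit.
Unset Printing Implicit Defensive.

Import Order.TTheory GRing.Theory Num.Theory.
Local Open Scope ring_scope.

Section ZeroExtension.
Context {R : realType} {I : finType} (N : {set I}).
Implicit Types (w : {ffun {i : I | i \in N} -> R}) (x : {ffun I -> R}).

Lemma zero_ext_val w (j : {i : I | i \in N}) : zero_ext w (val j) = w j.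
Proof. by rewrite ffunE valK. Qed.

Lemma zero_ext_notin w i : i \notin N -> zero_ext w i = 0.
Proof. by move=> iN; rewrite ffunE insubN. Qed.

Lemma zero_ext_restrict x :
  (forall i, i \notin N -> x i = 0) ->
  zero_ext [ffun j : {i : I | i \in N} => x (val j)] = x.
Proof.
move=> x0; apply/ffunP => i; have [iN|iN] := boolP (i \in N).
  by rewrite -[i]/(val (Sub i iN : {i : I | i \in N})) zero_ext_val ffunE.
by rewrite zero_ext_notin ?x0.
Qed.

(** A tuple with an entry outside [N] contributes nothing, its product having a zero factor; the
    remaining tuples are the images under [map val] of tuples over the subtype, each hit once. *)
Lemma sum_tuple_zero_ext (k : nat) (F : k.-tuple I -> R) w :
  \sum_(t : k.-tuple I) F t * \prod_(j <- t) zero_ext w j =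
  \sum_(t : k.-tuple {i : I | i \in N})
    F [tuple of map val t] * \prod_(j <- t) w j.
Proof.
pose h (t : k.-tuple {i : I | i \in N}) := [tuple of map val t].
have h_inj : injective h.
  move=> s t /(congr1 val) /= /(inj_map val_inj) st; exact: val_inj.
rewrite (bigID (mem [set h t | t in predT])) /= [X in _ + X]big1 ?addr0.
  rewrite big_imset /=; last exact: in2W.
  apply: eq_bigr => t _; rewrite big_map; congr (_ * _).
  by apply: eq_bigr => j _; rewrite zero_ext_val.
(* If all entries of [t] lay in [N], lifting them one by one to the subtype would give a preimage
   under [h], against [tNh]. *)
move=> t tNh; have [tN|/allPn[i it iN]] := boolP (all (mem N) t).
  have {}tN i : tnth t i \in N by exact: (all_tnthP tN i).
  case/imsetP: tNh.
  exists [tuple (Sub (tnth t i) (tN i) : {i : I | i \in N}) | i < k] => //.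
  by apply: eq_from_tnth => i; rewrite tnth_map tnth_mktuple.
by rewrite (big_rem i it) /= zero_ext_notin // mul0r mulr0.
Qed.

Lemma principal_subtensor_map (m : nat) (A : tensor R m.+1 I) w
    (i : {i : I | i \in N}) :
  tensor_map (principal_subtensor A N) w i = tensor_map A (zero_ext w) (val i).
Proof.
rewrite !ffunE sum_tuple_zero_ext; apply: eq_bigr => t _; rewrite ffunE.
by congr (A _ * _); apply: val_inj.
Qed.

(** Removes the subtype: sub-tensor and outside rows become rows of the single vector
    [tensor_map A (zero_ext w)], so later arguments only split on [i \in N]. *)
Lemma Pareto_H_supportE (m : nat) (A : tensor R m.+1 I) (lambda : R) w :
  Pareto_H_support A lambda w <->
  [/\ forall i, i \in N ->
        tensor_map A (zero_ext w) i = lambda * vec_pow m (zero_ext w) i,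
      forall i, i \in N -> 0 < zero_ext w i &
      forall i, i \notin N -> 0 <= tensor_map A (zero_ext w) i].
Proof.
have out i : tensor_map A (zero_ext w) i =
    \sum_(t : m.-tuple {i : I | i \in N})
      A [tuple of i :: map val t] * \prod_(j <- t) w j.
  rewrite ffunE sum_tuple_zero_ext; apply: eq_bigr => t _.
  by congr (A _ * _); apply: val_inj.
split=> -[eqN posN geN]; split=> i.
- move=> iN; move: (eqN (Sub i iN)).
  by rewrite principal_subtensor_map !ffunE insubT.
- by move=> iN; move: (posN (Sub i iN)); rewrite ffunE insubT.
- by move=> /geN; rewrite out.
- by rewrite principal_subtensor_map eqN ?(valP i) // !ffunE valK.
- by move: (posN _ (valP i)); rewrite zero_ext_val.
- by move=> /geN; rewrite out.
Qed.

End ZeroExtension.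

Section Complementarity.
Context {R : realType} {I : finType} {m : nat}.
Variables (A : tensor R m.+1 I) (lambda : R).

(** Splitting off the first index is a bijection between [m.+1]-tuples and pairs of an index and an
    [m]-tuple; the factor [x i] then comes out of the inner sum. *)
Lemma tensor_formE (x : {ffun I -> R}) :
  tensor_form A x = \sum_i x i * tensor_map A x i.
Proof.
transitivity (\sum_i \sum_(t : m.-tuple I)
    A [tuple of i :: t] * \prod_(j <- i :: t) x j).
  rewrite pair_big /tensor_form /=.
  rewrite (reindex (fun p : I * m.-tuple I => [tuple of p.1 :: p.2])) //=.
  exists (fun t : m.+1.-tuple I => (thead t, [tuple of behead t])) => [[i t]|t] _.
    by congr (_, _); apply: val_inj.
  by rewrite /= -tuple_eta.
apply: eq_bigr => i _; rewrite ffunE mulr_sumr; apply: eq_bigr => t _.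
by rewrite big_cons mulrCA.
Qed.

Lemma Pareto_H_complementarity (x : {ffun I -> R}) :
  Pareto_H_eigenvector A lambda x ->
  forall i, x i * (tensor_map A x i - lambda * vec_pow m x i) = 0.
Proof.
move=> [_ eq_form ge_map ge_x] i.
have sum0 : \sum_j x j * (tensor_map A x j - lambda * vec_pow m x j) = 0.
  under eq_bigr do rewrite mulrBr [x _ * (_ * _)]mulrCA.
  by rewrite sumrB -tensor_formE eq_form mulr_sumr subrr.
by apply: (psumr_eq0P _ sum0) => // j _; apply: mulr_ge0.
Qed.

Lemma Pareto_H_support_eigenvector (N : {set I})
    (w : {ffun {i : I | i \in N} -> R}) :
  (0 < m)%N -> N != set0 -> Pareto_H_support A lambda w ->
  Pareto_H_eigenvector A lambda (zero_ext w).
Proof.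
move=> m_gt0 /set0Pn[i0 i0N] /Pareto_H_supportE[eqN posN geN].
split.
(* The entry at [i0] is positive, so the vector is non-zero. *)
- by apply: contraTneq (posN _ i0N) => ->; rewrite ffunE ltxx.
- rewrite tensor_formE mulr_sumr; apply: eq_bigr => i _.
  have [iN|iN] := boolP (i \in N); first by rewrite eqN // mulrCA.
  by rewrite zero_ext_notin // !mul0r mulr0.
- move=> i; have [iN|iN] := boolP (i \in N); first by rewrite eqN ?subrr.
  (* Here [0 < m] matters: it makes [0 ^+ m] equal to 0 rather than 1, so the [lambda] term
     disappears. *)
  rewrite [vec_pow _ _ _]ffunE zero_ext_notin // expr0n gtn_eqF // mulr0 subr0.
  exact: geN.
- move=> i; have [iN|iN] := boolP (i \in N); first exact/ltW/posN.
  by rewrite zero_ext_notin.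
Qed.

Lemma Pareto_H_eigenvector_support (x : {ffun I -> R}) :
  (0 < m)%N -> Pareto_H_eigenvector A lambda x ->
  exists (N : {set I}) (w : {ffun {i : I | i \in N} -> R}),
    N != set0 /\ Pareto_H_support A lambda w.
Proof.
move=> m_gt0 xP; have [x_neq0 _ ge_map ge_x] := xP.
pose N := [set i | x i != 0].
have xN0 i : i \notin N -> x i = 0 by rewrite inE negbK => /eqP.
exists N, [ffun j => x (val j)]; split.
  apply: contraNneq x_neq0 => N0; apply/eqP/ffunP => i.
  by rewrite xN0 ?N0 ?inE // ffunE.
apply/Pareto_H_supportE; rewrite zero_ext_restrict //; split=> i.
(* On the support, the non-zero factor [x i] cancels from the complementarity identity. *)
- rewrite inE => xi0; apply/subr0_eq/(mulfI xi0).
  by rewrite Pareto_H_complementarity // mulr0.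
- by rewrite inE lt0r => ->; rewrite ge_x.
- move=> /xN0 xi0; move: (ge_map i).
  by rewrite [vec_pow _ _ _]ffunE xi0 expr0n gtn_eqF // mulr0 subr0.
Qed.

End Complementarity.

Theorem theorem3p1 (R : realType) (m n : nat) (hm : (2 <= m.+1)%N)
    (hn : (1 <= n)%N) (A : tensor R m.+1 'I_n) (lambda : R) :
  (Pareto_H_eigenvalue A lambda <->
   exists (N : {set 'I_n}) (w : {ffun {i : 'I_n | i \in N} -> R}),
     N != set0 /\ Pareto_H_support A lambda w)
  /\
  (forall (N : {set 'I_n}) (w : {ffun {i : 'I_n | i \in N} -> R}),
     N != set0 -> Pareto_H_support A lambda w ->
     Pareto_H_eigenvector A lambda (zero_ext w)).
Proof.
split; last by move=> N w; apply: Pareto_H_support_eigenvector.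
split=> [[x]|[N [w [N0 wP]]]]; first exact: Pareto_H_eigenvector_support.
by exists (zero_ext w); apply: Pareto_H_support_eigenvector.
Qed.
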